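(* Let $(F_n(X,Y))_{n\ge 0}$ be a sequence of nonzero polynomials with non-negative integer coefficients such that $F_n(0,0)=0$ for every $n\ge 0$. Define $(x_n)_{n\ge 0}$ by $x_0=1$, $x_1\in\mathbb{Z}_{>0}$ and $$x_{n+2}x_n=x_{n+1}^2\bigl(F_n(x_n,x_{n+1})+1\bigr)\qquad(n\ge 0).$$ Then for any positive integer $h$, the alternating series $T=\sum_{n=0}^{\infty}(-1)^n\frac{h^n}{x_{n+1}}$ has the infinite continued fraction expansion $$T=\cfrac{a_1}{b_1+\cfrac{a_2}{b_2+\cfrac{a_3}{b_3+\cdots}}},$$ where $$a_1=1,\quad a_2=hx_1,\quad a_3=h,\quad a_4=x_1,$$ $$b_1=x_1,\quad b_2=\frac{x_2}{x_1}-h,\quad b_3=F_1(x_1,x_2)+1-x_1,\quad b_4=1,$$ and for $k\ge 2$ $$a_{3k-1}=h^k,\quad a_{3k}=h^{k-1},\quad a_{3k+1}=1,$$ $$b_{3k-1}=h^{k-1}(x_k-h),\quad b_{3k}=\frac{F_k(x_k,x_{k+1})}{x_k}-1,\quad b_{3k+1}=1.$$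
   Context: The value of an infinite continued fraction with partial numerators $a_m$ and partial denominators $b_m$ is $\lim_{m\to\infty}P_m/Q_m$, where $P_0=0$, $Q_0=1$, $P_1=a_1$, $Q_1=b_1$, and $P_{k+2}=b_{k+2}P_{k+1}+a_{k+2}P_k$, $Q_{k+2}=b_{k+2}Q_{k+1}+a_{k+2}Q_k$ for $k\ge 0$ (the limit being taken over $m$ large enough that $Q_m\ne 0$). *)

(* Defs.v *)
From HB Require Import structures.
From mathcomp Require Import all_boot all_order all_algebra.
From mathcomp Require Import all_classical all_reals all_analysis.
Set Implicit Arguments.
Unset Strict Implicit.
Unset Printing Implicit Defensive.
Import Order.TTheory GRing.Theory Num.Theory.
Import numFieldNormedType.Exports.
Local Open Scope classical_set_scope.
Local Open Scope ring_scope.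

(* G(x, y) for G in Z[X, Y] = {poly {poly int}}. As in polyXY, the outer
   variable is X and the inner one is Y, so G`_i`_j is the coefficient of
   X^i Y^j. *)
Definition evalXY (R : comNzRingType) (G : {poly {poly int}}) (x y : R) : R :=
  (map_poly (map_poly (intr : int -> R)) G).[x, y].

(* Partial numerators and denominators are indexed from 1; the values of a
   and b at 0 are never used. *)
Fixpoint cfracP (R : nzRingType) (a b : nat -> R) (m : nat) : R :=
  match m with
  | 0 => 0
  | S m' => match m' with
            | 0 => a 1%N
            | S k => b k.+2 * cfracP a b m' + a k.+2 * cfracP a b k
            end
  end.

Fixpoint cfracQ (R : nzRingType) (a b : nat -> R) (m : nat) : R :=
  match m with
  | 0 => 1
  | S m' => match m' with
            | 0 => b 1%N
            | S k => b k.+2 * cfracQ a b m' + a k.+2 * cfracQ a b k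
            end
  end.

(* The first conjunct makes P_m / Q_m a genuine quotient for all large m
   (division by 0 is total in the library). *)
Definition is_cfrac_value (R : realType) (a b : nat -> R) (T : R) : Prop :=
  (\forall m \near \oo, cfracQ a b m != 0) /\
  ((cfracP a b m / cfracQ a b m) @[m --> \oo] --> T).

(* Main.v *)
(* Since F_n has non-negative integer coefficients and no constant term,
   F_n(x_n, x_{n+1}) >= x_n; hence x_{n+1} >= (n+1) x_n, so x_n >= n! and the
   series converges by comparison with exp(h).

   Let s_n be the n-th partial sum, y_n = x_{n+1} / x_n, d_1 = x_1 and
   d_{q+1} = h^q d_q.  Induction on q >= 1 with the three-term recurrence gives
     P_{3q+1} = d_q (y_{q+1} s_{q+2} + h s_{q+1}),
     P_{3q+2} = d_{q+1} x_{q+2} s_{q+2},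
     P_{3q+3} = d_{q+1} (y_{q+2} s_{q+3} + (h - x_{q+2}) s_{q+2}),
   and the same formulas with s = 1 for Q.  As y_{q+2} >= x_{q+2} + 1, the Q_m
   are nonzero and P_m / Q_m is within h^{q+1} / x_{q+1} of s_{q+1} for
   q = m / 3 >= 2. *)
Require Import Defs.
From HB Require Import structures.
From mathcomp Require Import all_boot all_order all_algebra.
From mathcomp Require Import ring lra zify.
From mathcomp Require Import all_classical all_reals all_analysis.
Set Implicit Arguments.
Unset Strict Implicit.
Unset Printing Implicit Defensive.
Import Order.TTheory GRing.Theory Num.Theory.
Import numFieldNormedType.Exports.
Local Open Scope classical_set_scope.
Local Open Scope ring_scope.

(** * Lower bound for values of bivariate integer polynomials *)

Lemma evalXYE (R : comNzRingType) (G : {poly {poly int}}) (u v : R) :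
  evalXY G u v =
  \sum_(i < size G) (\sum_(j < size G`_i) (G`_i`_j)%:~R * v ^+ j) * u ^+ i.
Proof.
rewrite /evalXY (@horner_coef_wide _ (size G) _ u%:P) ?size_poly// horner_sum.
apply: eq_bigr => i _; rewrite !hornerE.
congr (_ * _); rewrite coef_map_id0 ?map_poly0//.
rewrite (@horner_coef_wide _ (size G`_i)) ?size_poly//.
by apply: eq_bigr => j _; rewrite coef_map_id0.
Qed.

(** The leading coefficient in [X], then in [Y], singles out a monomial with coefficient at least 1.
    It is not constant since [G] vanishes at the origin, so at [1 <= u <= v] it is at least [u]; the
    other terms are non-negative. *)
Lemma evalXY_ge (R : realDomainType) (G : {poly {poly int}}) (u v : R) :
  G != 0 -> (forall i j, 0 <= G`_i`_j) -> G.[0, 0] = 0 ->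
  1 <= u -> u <= v -> u <= evalXY G u v.
Proof.
move=> G0 Gge0 G00 u1 uv; have v1 : 1 <= v := le_trans u1 uv.
have u0 : 0 <= u := le_trans ler01 u1.
have v0 : 0 <= v := le_trans ler01 v1.
have term_ge0 i j : 0 <= (G`_i`_j)%:~R * v ^+ j :> R.
  by rewrite mulr_ge0 ?ler0z ?exprn_ge0.
have sG : (0 < size G)%N by rewrite size_poly_gt0.
pose i0 := (size G).-1; have li0 : (i0 < size G)%N by rewrite prednK.
have Gi0 : G`_i0 != 0 by rewrite -lead_coefE lead_coef_eq0.
have sGi : (0 < size (G`_i0)%R)%N by rewrite size_poly_gt0.
pose j0 := (size G`_i0).-1.
have lj0 : (j0 < size (G`_i0)%R)%N by rewrite prednK.
have Gij1 : 1 <= (G`_i0`_j0)%:~R :> R.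
  rewrite ler1z -gtz0_ge1 lt_neqAle Gge0 andbT eq_sym.
  by rewrite -lead_coefE lead_coef_eq0.
have ij0 : (0 < i0)%N || (0 < j0)%N.
  rewrite !lt0n -negb_and; apply/negP => /andP[/eqP i00 /eqP j00].
  by move: G00 Gij1; rewrite i00 j00 !horner_coef0 => ->; rewrite ler10.
rewrite evalXYE (bigD1 (Ordinal li0))//= (bigD1 (Ordinal lj0))//=.
have rest_ge0 : 0 <= \sum_(i < size G | i != Ordinal li0)
    (\sum_(j < size G`_i) (G`_i`_j)%:~R * v ^+ j) * u ^+ i.
  by apply: sumr_ge0 => i _; rewrite mulr_ge0 ?exprn_ge0// sumr_ge0.
apply: (@le_trans _ _ (v ^+ j0 * u ^+ i0)); last first.
  rewrite -[leLHS]addr0 lerD// ler_wpM2r ?exprn_ge0//.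
  by rewrite -[leLHS]addr0 lerD ?sumr_ge0// ler_peMl ?exprn_ge0.
case/orP: ij0 => [i0_gt0 | j0_gt0].
  have uui : u <= u ^+ i0 by rewrite ler_eXnr.
  by apply: (le_trans uui); rewrite ler_peMl ?exprn_ge0// exprn_ege1.
have vvj : v <= v ^+ j0 by rewrite ler_eXnr.
apply: (le_trans uv); apply: (le_trans vvj).
by rewrite ler_peMr ?exprn_ge0// exprn_ege1.
Qed.

(** * Growth of [x] and convergence of the alternating series *)

Section Expansion.

Variables (R : realType) (x f : nat -> R) (h : nat).
Hypothesis h_gt0 : (0 < h)%N.
Hypotheses (x_0 : x 0%N = 1) (x_1 : 1 <= x 1%N).
Hypothesis x_rec : forall n, x n.+2 * x n = x n.+1 ^+ 2 * (f n + 1).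
Hypothesis f_ge : forall n, 1 <= x n -> x n <= x n.+1 -> x n <= f n.

(** The ratio of consecutive terms is multiplied by [f n + 1 >= 2] at each step, and
    [2 * N >= N + 1] for [N >= 1]. Both conjuncts go through one induction because together they
    supply the premises of [f_ge]. *)
Lemma x_growth n : 1 <= x n /\ n.+1%:R * x n <= x n.+1.
Proof.
elim: n => [|n [x1 xS]]; first by rewrite x_0 mul1r.
have : 1 <= n.+1%:R :> R by rewrite ler1n.
rewrite -[n.+2%:R]natr1; move: (n.+1%:R) xS => N xS N1.
have xle : x n <= x n.+1 by apply: le_trans xS; rewrite ler_peMl//; lra.
split; first by lra.
have fx := f_ge x1 xle; have xn0 : 0 < x n by lra.
rewrite -(ler_pM2r xn0) x_rec.
apply: (@le_trans _ _ (x n.+1 * (N * x n) * 2)); first last.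
  have : 0 <= x n.+1 ^+ 2 * (f n - 1) by rewrite mulr_ge0 ?sqr_ge0//; lra.
  have : x n.+1 * (N * x n) <= x n.+1 ^+ 2 by rewrite expr2 ler_wpM2l//; lra.
  by lra.
have : 0 <= x n.+1 * x n * (N - 1) by rewrite !mulr_ge0//; lra.
by lra.
Qed.

Lemma x_ge1 n : 1 <= x n. Proof. by case: (x_growth n). Qed.

Lemma x_gt0 n : 0 < x n. Proof. exact: lt_le_trans ltr01 (x_ge1 n). Qed.

Lemma x_nondecreasing n : x n <= x n.+1.
Proof.
case: (x_growth n) => x1 xS; have n1 : 1 <= n.+1%:R :> R by rewrite ler1n.
by apply: le_trans xS; rewrite ler_peMl// (le_trans ler01).
Qed.

Lemma fact_le_x n : n`!%:R <= x n.
Proof.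
elim: n => [|n IHn]; first by rewrite x_0.
case: (x_growth n) => _; apply: le_trans.
by rewrite factS natrM ler_wpM2l.
Qed.

Lemma xSE n : x n.+2 = x n.+1 ^+ 2 * (f n + 1) / x n.
Proof. by rewrite -x_rec mulfK ?gt_eqF ?x_gt0. Qed.

Definition altTerm n : R := (-1) ^+ n * (h%:R ^+ n / x n.+1).

Lemma norm_altTerm n : `|altTerm n| = h%:R ^+ n / x n.+1.
Proof.
rewrite normrM normrX normrN1 expr1n mul1r ger0_norm//.
by rewrite divr_ge0 ?exprn_ge0// ltW ?x_gt0.
Qed.

Lemma norm_altTerm_le_exp n : `|altTerm n| <= exp_coeff h%:R n.
Proof.
rewrite norm_altTerm /exp_coeff /= ler_wpM2l ?exprn_ge0//.
rewrite lef_pV2 ?posrE ?x_gt0 ?ltr0n ?fact_gt0//.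
exact: le_trans (fact_le_x n) (x_nondecreasing n).
Qed.

Lemma is_cvg_altSeries : cvgn (series altTerm).
Proof.
apply: normed_cvg; apply: series_le_cvg norm_altTerm_le_exp _ => //.
  by move=> n; rewrite exp_coeff_ge0.
exact: is_cvg_series_exp_coeff.
Qed.

(* Both the partial sums of the alternating series and the constant sequence
   1 satisfy this relation; the former governs the P_m, the latter the Q_m. *)
Definition alternating (s : nat -> R) :=
  forall n, x n.+2 * (s n.+2 - s n.+1) = - h%:R * x n.+1 * (s n.+1 - s n).

Lemma alternating_series : alternating (series altTerm).
Proof.
move=> n; rewrite !seriesSB /altTerm.
have := x_gt0 n.+1; have := x_gt0 n.+2 => p2 p1; rewrite !exprS.
by field; rewrite !gt_eqF.
Qed.

Lemma alternating_cst c : alternating (fun=> c).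
Proof. by move=> n; rewrite !subrr !mulr0. Qed.

(** Eliminates the newest value, so that the continuant identities become rational identities in
    [s n] and [s n.+1], within reach of [field]. *)
Lemma alternatingE s n : alternating s ->
  s n.+2 = s n.+1 - h%:R * x n.+1 * (s n.+1 - s n) / x n.+2.
Proof.
move=> /(_ n); have := x_gt0 n.+2 => p2 e.
apply: (mulfI (lt0r_neq0 p2)); rewrite mulrBr mulrCA divff ?gt_eqF//.
by lra.
Qed.

Variables a b : nat -> R.
Hypotheses (a_3 : a 3%N = h%:R) (a_4 : a 4%N = x 1%N).
Hypotheses (b_3 : b 3%N = f 1%N + 1 - x 1%N) (b_4 : b 4%N = 1).
Hypothesis a_3k_sub1 : forall k, (2 <= k)%N -> a (3 * k - 1)%N = h%:R ^+ k.
Hypothesis a_3k : forall k, (2 <= k)%N -> a (3 * k)%N = h%:R ^+ (k - 1).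
Hypothesis a_3k_add1 : forall k, (2 <= k)%N -> a (3 * k + 1)%N = 1.
Hypothesis b_3k_sub1 : forall k, (2 <= k)%N ->
  b (3 * k - 1)%N = h%:R ^+ (k - 1) * (x k - h%:R).
Hypothesis b_3k : forall k, (2 <= k)%N -> b (3 * k)%N = f k / x k - 1.
Hypothesis b_3k_add1 : forall k, (2 <= k)%N -> b (3 * k + 1)%N = 1.

(* The common factor of P_m and Q_m. *)
Definition scale q : R := x 1%N * h%:R ^+ 'C(q, 2).

Lemma scaleS q : scale q.+1 = h%:R ^+ q * scale q.
Proof. by rewrite /scale binS bin1 addnC exprD mulrCA. Qed.

(** * Closed forms shared by the continuants [P] and [Q] *)

Section Continuant.

Variables s W : nat -> R.
Hypothesis s_alt : alternating s.
Hypothesis W_rec : forall k, W k.+2 = b k.+2 * W k.+1 + a k.+2 * W k.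
Hypotheses (W_1 : W 1%N = x 1%N * s 1%N) (W_2 : W 2%N = x 2%N * s 2%N).

Let W_3q3 q : (0 < q)%N ->
  W (3 * q).+3 =
  (f q.+1 / x q.+1 - 1) * W (3 * q).+2 + h%:R ^+ q * W (3 * q).+1.
Proof.
move=> q0; rewrite W_rec.
have -> : (3 * q).+3 = (3 * q.+1)%N by lia.
by rewrite b_3k// a_3k// subn1.
Qed.

Let W_3q4 q : (0 < q)%N -> W (3 * q).+4 = W (3 * q).+3 + W (3 * q).+2.
Proof.
move=> q0; rewrite W_rec.
have -> : (3 * q).+4 = (3 * q.+1 + 1)%N by lia.
by rewrite b_3k_add1// a_3k_add1// !mul1r.
Qed.

(** The regular pattern applies with [k = q.+2], so [q = 0] is covered and yields [W 5]. *)
Let W_3q5 q :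
  W (3 * q).+4.+1 = h%:R ^+ q.+1 * (x q.+2 - h%:R) * W (3 * q).+4 +
    h%:R ^+ q.+2 * W (3 * q).+3.
Proof.
rewrite W_rec.
have -> : (3 * q).+4.+1 = (3 * q.+2 - 1)%N by lia.
by rewrite b_3k_sub1// a_3k_sub1// subn1.
Qed.

Lemma continuant_3q12 q : (0 < q)%N ->
  W (3 * q).+1 = scale q * (x q.+2 / x q.+1 * s q.+2 + h%:R * s q.+1) /\
  W (3 * q).+2 = scale q.+1 * x q.+2 * s q.+2.
Proof.
elim: q => // q IHq _; have -> : (3 * q.+1 = (3 * q).+3)%N by lia.
have p1 := gt_eqF (x_gt0 q.+1); have p2 := gt_eqF (x_gt0 q.+2).
(* After [xSE], this factor sits in the denominator of the expression for [s q.+3]. *)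
have f0 : f q.+1 + 1 == 0 = false.
  have := f_ge (x_ge1 q.+1) (x_nondecreasing q.+1); have := x_gt0 q.+1.
  by move=> ? ?; apply/negbTE; rewrite lt0r_neq0//; lra.
(* The base case computes [W 3] and [W 4] from the irregular third and fourth coefficients; later
   cases follow the regular pattern. *)
case: q IHq p1 p2 f0 => [|q] IHq p1 p2 f0.
  have W3 : W 3%N = (f 1%N + 1 - x 1%N) * (x 2%N * s 2%N)
      + h%:R * (x 1%N * s 1%N) by rewrite W_rec W_1 W_2 a_3 b_3.
  have W4 : W 4%N = W 3%N + x 1%N * (x 2%N * s 2%N).
    by rewrite W_rec b_4 a_4 W_2 mul1r.
  have W5 := W_3q5 0; rewrite muln0 in W5 *.
  rewrite W5 W4 W3 (alternatingE 1 s_alt) (xSE 1) (scaleS 1).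
  have -> : scale 1 = x 1%N by rewrite /scale mulr1.
  by split; field; rewrite ?p1 ?p2 ?f0.
have [IH1 IH2] := IHq isT.
rewrite W_3q5 W_3q4// W_3q3// IH1 IH2.
rewrite (alternatingE q.+2 s_alt) (xSE q.+2) (scaleS q.+2) (scaleS q.+1).
by rewrite !exprS; split; field; rewrite ?p1 ?p2 ?f0.
Qed.

(** Since [W (3 * q).+4] is the sum of the two preceding values, this one is a difference of two
    known closed forms. *)
Lemma continuant_3q3 q : (0 < q)%N ->
  W (3 * q).+3 = scale q.+1 *
    (x q.+3 / x q.+2 * s q.+3 + (h%:R - x q.+2) * s q.+2).
Proof.
move=> q0; have [e1 _] := @continuant_3q12 q.+1 isT.
have [_ e2] := continuant_3q12 q0.
have := W_3q4 q0; rewrite -[(3 * q).+4]/((3 * q).+3).+1.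
have -> : (3 * q).+3 = (3 * q.+1)%N by lia.
rewrite e1 e2 => e; apply: (addIr (scale q.+1 * x q.+2 * s q.+2)).
by rewrite -e; ring.
Qed.

End Continuant.

(** * Distance from the convergents to the partial sums, and the limit *)

Hypotheses (a_1 : a 1%N = 1) (a_2 : a 2%N = h%:R * x 1%N).
Hypotheses (b_1 : b 1%N = x 1%N) (b_2 : b 2%N = x 2%N / x 1%N - h%:R).

Let s : nat -> R := series altTerm.
Let P := cfracP a b.
Let Q := cfracQ a b.

Let s1 : s 1%N = (x 1%N)^-1.
Proof. by rewrite /s /series/= big_nat1 /altTerm !expr0 !mul1r. Qed.

Let s2 : s 2%N = (x 1%N)^-1 - h%:R / x 2%N.
Proof.
by rewrite /s seriesSr -/s s1 /altTerm !expr1 mulN1r.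
Qed.

Let P_1 : P 1%N = x 1%N * s 1%N.
Proof. by rewrite /P/= a_1 s1 divff// gt_eqF ?x_gt0. Qed.

Let P_2 : P 2%N = x 2%N * s 2%N.
Proof.
have := x_gt0 1; have := x_gt0 2 => p2 p1.
by rewrite /P/= a_1 b_2 s2; field; rewrite !gt_eqF.
Qed.

Let Q_1 : Q 1%N = x 1%N * 1.
Proof. by rewrite /Q/= b_1 mulr1. Qed.

Let Q_2 : Q 2%N = x 2%N * 1.
Proof.
have := x_gt0 1 => p1.
by rewrite /Q/= b_1 b_2 a_2; field; rewrite !gt_eqF.
Qed.

(** With [q = m %/ 3], the error is [c * altTerm q.+1], where [c] is [y / (y + h - x q.+1)],
    [y / (y + h)] or [1] according to [m] modulo 3. In each case [0 <= c <= y], and [y] converts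
    [altTerm q.+1] into the bound. The threshold 6 makes [p = q - 1] positive when 3 divides [m]. *)
Lemma convergent_dist m : (6 <= m)%N ->
  Q m != 0 /\ `|P m / Q m - s (m %/ 3).+1| <= h%:R * `|altTerm (m %/ 3)|.
Proof.
have PC12 := @continuant_3q12 s P alternating_series (fun=> erefl) P_1 P_2.
have QC12 := @continuant_3q12 (fun=> 1) Q (alternating_cst 1) (fun=> erefl) Q_1 Q_2.
have PC3 := @continuant_3q3 s P alternating_series (fun=> erefl) P_1 P_2.
have QC3 := @continuant_3q3 (fun=> 1) Q (alternating_cst 1) (fun=> erefl) Q_1 Q_2.
have scale_neq0 q : scale q != 0.
  by rewrite mulf_neq0 ?expf_neq0 ?pnatr_eq0 -?lt0n// gt_eqF ?x_gt0.
move=> m6; set q := (m %/ 3)%N; set B := h%:R * _.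
have q2 : (1 < q)%N by rewrite /q; lia.
have sS : s q.+2 = s q.+1 + altTerm q.+1 by rewrite /s seriesSr.
have x1 := x_gt0 q.+1; have x2 := x_gt0 q.+2.
set y := x q.+2 / x q.+1.
have y_ge1 : 1 <= y by rewrite ler_pdivlMr// mul1r x_nondecreasing.
have yB : y * `|altTerm q.+1| = B.
  by rewrite /B !norm_altTerm exprS /y; field; rewrite !gt_eqF.
have le_B c : `|c| <= y -> `|c * altTerm q.+1| <= B.
  by move=> cy; rewrite normrM -yB ler_wpM2r.
have h0 : 0 < h%:R :> R by rewrite ltr0n.
have : (m = 3 * q + m %% 3)%N by rewrite mulnC -divn_eq.
have := ltn_pmod m (isT : (0 < 3)%N).
case: (m %% 3)%N => [|[|[|//]]] _ ->; rewrite ?addn0 ?addn1 ?addn2.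
- have [p qp] : exists p, q = p.+1 by exists q.-1; rewrite prednK// ltnW.
  have p0 : (0 < p)%N by rewrite -ltnS -qp.
  have -> : (3 * q = (3 * p).+3)%N by rewrite qp; lia.
  rewrite PC3// QC3// -!qp -/y !mulr1.
  (* The weight [h - x q.+1] may be negative, but the recurrence and [f q >= x q] give
     [y >= x q.+1 + x q.+1 / x q >= x q.+1 + 1]. *)
  have den_ge1 : 1 <= y + (h%:R - x q.+1).
    have fx := f_ge (x_ge1 q) (x_nondecreasing q); have xq := x_gt0 q.
    have : x q.+1 / x q * (x q + 1) <= y.
      rewrite /y xSE.
      have -> : x q.+1 ^+ 2 * (f q + 1) / x q / x q.+1 =
        x q.+1 / x q * (f q + 1) by field; rewrite !gt_eqF.
      by rewrite ler_wpM2l ?lerD2r// divr_ge0// ltW.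
    rewrite mulrDr mulr1 divfK ?gt_eqF//.
    have : 1 <= x q.+1 / x q by rewrite ler_pdivlMr// mul1r x_nondecreasing.
    by lra.
  have den0 : y + (h%:R - x q.+1) != 0 by rewrite gt_eqF//; lra.
  split; first by rewrite mulf_neq0.
  rewrite (_ : _ - _ = y / (y + (h%:R - x q.+1)) * altTerm q.+1); last first.
    by rewrite sS; field; rewrite den0 scale_neq0.
  apply: le_B; rewrite ger0_norm ?divr_ge0//; try lra.
  by rewrite ler_pdivrMr ?ler_peMr//; lra.
- have [-> _] := PC12 q (ltnW q2); have [-> _] := QC12 q (ltnW q2).
  rewrite -/y !mulr1.
  have den0 : y + h%:R != 0 by rewrite gt_eqF//; lra.
  split; first by rewrite mulf_neq0.
  rewrite (_ : _ - _ = y / (y + h%:R) * altTerm q.+1); last first.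
    by rewrite sS; field; rewrite den0 scale_neq0.
  apply: le_B; rewrite ger0_norm ?divr_ge0//; try lra.
  by rewrite ler_pdivrMr ?ler_peMr//; nra.
- have [_ ->] := PC12 q (ltnW q2); have [_ ->] := QC12 q (ltnW q2).
  have den0 : scale q.+1 * x q.+2 != 0 by rewrite mulf_neq0// gt_eqF.
  rewrite mulr1; split=> //.
  rewrite (_ : _ - _ = 1 * altTerm q.+1); first by apply: le_B; rewrite normr1.
  by rewrite sS mulrC mulKf// mul1r addrAC subrr add0r.
Qed.

Lemma convergents_cvg :
  (\forall m \near \oo, Q m != 0) /\
  ((P m / Q m) @[m --> \oo] --> limn s).
Proof.
split; first by near=> m; apply: (convergent_dist _).1; near: m; exists 6%N.
have div3 : (m %/ 3)%N @[m --> \oo] --> \oo by exact: cvg_divnr.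
have s_cvg : s (m %/ 3).+1 @[m --> \oo] --> limn s.
  apply: (cvg_comp _ (fun q => s q.+1) div3).
  by rewrite cvg_shiftS; exact: is_cvg_altSeries.
apply: (cvg_sub0 _ s_cvg); apply: norm_cvg0.
(* The bound vanishes in the limit because the terms of a convergent series tend to 0. *)
have bound_cvg : h%:R * `|altTerm (m %/ 3)| @[m --> \oo] --> (0 : R).
  rewrite -(mulr0 h%:R); apply: cvgMr.
  rewrite -(normr0 R); apply: cvg_norm.
  exact: cvg_comp div3 (cvg_series_cvg_0 is_cvg_altSeries).
apply: squeeze_cvgr (cvg_cst 0) bound_cvg.
near=> m; rewrite normr_ge0 /=; apply: (convergent_dist _).2.
by near: m; exists 6%N.
Unshelve. all: by end_near. Qed.

End Expansion.

Theorem mainTheorem5 (R : realType) (F : nat -> {poly {poly int}})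
  (F_neq0 : forall n, F n != 0)
  (F_ge0 : forall n i j, 0 <= (F n)`_i`_j)
  (F_00 : forall n, (F n).[0, 0] = 0)
  (x : nat -> R) (x1 : nat) (x1_gt0 : (0 < x1)%N)
  (x_0 : x 0%N = 1) (x_1 : x 1%N = x1%:R)
  (x_rec : forall n,
    x n.+2 * x n = x n.+1 ^+ 2 * (evalXY (F n) (x n) (x n.+1) + 1))
  (h : nat) (h_gt0 : (0 < h)%N)
  (a b : nat -> R)
  (a_1 : a 1%N = 1)
  (a_2 : a 2%N = h%:R * x 1%N)
  (a_3 : a 3%N = h%:R)
  (a_4 : a 4%N = x 1%N)
  (b_1 : b 1%N = x 1%N)
  (b_2 : b 2%N = x 2%N / x 1%N - h%:R)
  (b_3 : b 3%N = evalXY (F 1%N) (x 1%N) (x 2%N) + 1 - x 1%N)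
  (b_4 : b 4%N = 1)
  (a_3k_sub1 : forall k, (2 <= k)%N -> a (3 * k - 1)%N = h%:R ^+ k)
  (a_3k : forall k, (2 <= k)%N -> a (3 * k)%N = h%:R ^+ (k - 1))
  (a_3k_add1 : forall k, (2 <= k)%N -> a (3 * k + 1)%N = 1)
  (b_3k_sub1 : forall k, (2 <= k)%N ->
    b (3 * k - 1)%N = h%:R ^+ (k - 1) * (x k - h%:R))
  (b_3k : forall k, (2 <= k)%N ->
    b (3 * k)%N = evalXY (F k) (x k) (x k.+1) / x k - 1)
  (b_3k_add1 : forall k, (2 <= k)%N -> b (3 * k + 1)%N = 1) :
  exists T : R,
    (series (fun n => (-1) ^+ n * (h%:R ^+ n / x n.+1)) @ \oo --> T) /\
    is_cfrac_value a b T.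
Proof.
(* The polynomials enter the expansion through these values and their lower bound [x n]. *)
pose f n := evalXY (F n) (x n) (x n.+1).
have f_ge n : 1 <= x n -> x n <= x n.+1 -> x n <= f n.
  by move=> *; exact: evalXY_ge.
have x1_ge1 : 1 <= x 1%N by rewrite x_1 ler1n.
exists (limn (series (altTerm x h))); split.
  exact: (is_cvg_altSeries x_0 x1_ge1 x_rec f_ge).
exact: (convergents_cvg h_gt0 x_0 x1_ge1 x_rec f_ge).
Qed.
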